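(* For every finite simple graph $G$, $\tau(G)\leq \frac{162+4\sqrt{3}}{59}\,\nu(G)$.
   Context: A triangle in a graph $G$ is a subgraph isomorphic to $K_3$. $\nu(G)$ denotes the maximum number of pairwise edge-disjoint triangles in $G$. $\tau(G)$ denotes the minimum size of a triangle transversal of $G$, i.e. of a set of edges of $G$ that contains at least one edge of every triangle of $G$. *)

(* Defs.v *)
(* A finite simple graph is a symmetric irreflexive relation
   [e : rel T] on a finite type [T] of vertices; an edge is the two-element set
   of its end points. *)
From mathcomp Require Import all_boot all_order all_algebra.

Set Implicit Arguments.
Unset Strict Implicit.
Unset Printing Implicit Defensive.

Definition edges (T : finType) (e : rel T) : {set {set T}} :=
  [set [set p.1; p.2] | p in [pred p : T * T | e p.1 p.2]].

(* A subgraph isomorphic to K_3 contains all three pairs of its vertices, so it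
   is determined by its vertex set, and is represented by it. *)
Definition triangles (T : finType) (e : rel T) : {set {set T}} :=
  [set t : {set T} |
    (#|t| == 3) && [forall x in t, forall y in t, (x != y) ==> e x y]].

Definition triangle_edges (T : finType) (t : {set T}) : {set {set T}} :=
  [set f : {set T} | (f \subset t) && (#|f| == 2)].

Definition triangle_packing (T : finType) (e : rel T) (P : {set {set T}}) :
    bool :=
  (P \subset triangles e) &&
  [forall s in P, forall t in P,
     (s != t) ==> [disjoint triangle_edges s & triangle_edges t]].

Definition triangle_transversal (T : finType) (e : rel T) (F : {set {set T}}) :
    bool :=
  (F \subset edges e) &&
  [forall t in triangles e, exists f in triangle_edges t, f \in F].

Definition nu (T : finType) (e : rel T) : nat :=
  \max_(P : {set {set T}} | triangle_packing e P) #|P|.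

(* [arg min] is only meaningful if its default value satisfies the predicate:
   see [edges_transversal]. *)
Definition tau (T : finType) (e : rel T) : nat :=
  #|[arg min_(F < edges e | triangle_transversal e F) #|F|]|.

Lemma edges_transversal (T : finType) (e : rel T) :
  triangle_transversal e (edges e).
Proof.
apply/andP; split=> //; apply/forall_inP=> t; rewrite inE => /andP[/eqP t3 te].
have /card_gt1P[x [y [xt yt xy]]] : 1 < #|t| by rewrite t3.
apply/exists_inP; exists [set x; y].
  by rewrite inE subUset !sub1set xt yt cards2 xy.
apply/imsetP; exists (x, y) => //=; rewrite inE /=.
by move/forall_inP: te => /(_ x xt) /forall_inP /(_ y yt) /implyP; apply.
Qed.

(* Main.v *)
Require Import Defs.
From mathcomp Require Import all_boot all_order all_algebra.
From mathcomp Require Import zify lra.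

(** The bound proved is 20 tau <= 57 nu; it suffices because
    57/20 = 2.85 is less than (162 + 4 sqrt 3)/59 = 2.863...

    The edges of a maximum triangle packing form a transversal, of size 3 nu,
    so some edges must be saved.  They are saved on diamonds.  A diamond is a
    pair of triangles with a common edge, its spine; its other four edges are
    its legs, and its crossbar is the pair of its two non-adjacent vertices.
    A family of n pairwise edge-disjoint units, d of them diamonds and the
    others single triangles, packs n triangles.  A triangle that meets a
    diamond in one leg only leaves one of the two triangles of the diamond
    intact, so if it meets every unit in at most one edge, always a leg, then
    it can be added to the packing at the price of at most three diamonds.  In
    a family maximizing 4n + d this cannot happen ([no_swap]).  A triangle with
    two legs of a diamond, other than the two triangles of the diamond, contains
    its crossbar ([crossbar_edge]).  Hence all edges of the single triangles,
    with the spine and the crossbar of every diamond, form a transversal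
    ([core_hits]), which gives tau + d <= 3n ([tau_first_core]).

    If d is small, put the d spines in the transversal.  Every triangle left
    has at least two edges among the at most 3n + d other edges of the family,
    the sides ([two_sides]), since a triangle with fewer would improve the
    family.  Take a second optimal family, among the triangles left, with n'
    units of which p are diamonds; it maximizes first the number m of units
    whose triangle has exactly two sides, and then 4n' + p.  It yields three
    transversals.  One takes the sides in the m triangles with exactly two of
    them, and half of the remaining relevant edges, chosen by a bipartition of
    the vertices ([tau_half]).  One is the transversal of the first step for
    the second family ([tau_second_core]).  One takes, besides the sides in the
    triangles of the second family, the legs of its diamonds
    ([tau_second_legs]).  In the last two the number y of diamonds whose spine
    lies in a third triangle, off the rest of the family, enters with opposite
    signs: such a third triangle saves the crossbar, but costs the spine.
    Finally the second family competes with the first one, so that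
    4n' + p <= 4n + d ([score_compare]).

    The sum of the bounds of [tau_second_legs] and [tau_second_core] is
    2 tau + m <= 2d + 6n' + p, hence at most 3d + 4n + 2 nu.  Three times this,
    plus the bound of [tau_half] and twelve times that of [tau_first_core],
    is 20 tau <= 51n + 6 nu <= 57 nu. *)

Set Implicit Arguments.
Unset Strict Implicit.
Unset Printing Implicit Defensive.

(** * Triangles, diamonds and bipartitions *)

Lemma card_setId_sum (I : finType) (X : {set I}) (P : pred I) :
  #|[set x in X | P x]| = \sum_(x in X) P x.
Proof.
rewrite -sum1dep_card big_mkcondr /=; apply: eq_bigr => x _; by case: (P x).
Qed.

Lemma card_bigcup_leq (I X : finType) (U : {set I}) (F : I -> {set X}) :
  #|\bigcup_(i in U) F i| <= \sum_(i in U) #|F i|.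
Proof.
elim/big_rec2: _ => [|i m S _ le]; first by rewrite cards0.
by apply: leq_trans (leq_card_setU _ _) _; rewrite leq_add2l.
Qed.

Section Geometry.

Variable T : finType.
Implicit Types (s t r f g : {set T}).
Local Notation E := triangle_edges.

Lemma card_triangle_edges t : #|t| = 3 -> #|E t| = 3.
Proof. by move=> t3; rewrite /triangle_edges cards_draws t3. Qed.

Lemma setU_shared_edges t f g :
  #|t| = 3 -> f \in E t -> g \in E t -> f != g -> f :|: g = t.
Proof.
rewrite !inE => t3 /andP[ft /eqP f2] /andP[gt /eqP g2] fg.
apply/eqP; rewrite eqEcard subUset ft gt t3 /=.
have: f \proper f :|: g.
  rewrite properE subsetUl subUset subxx /=; apply: contra fg => gf.
  by rewrite eq_sym eqEcard gf f2 g2.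
by move/proper_card; rewrite f2.
Qed.

Lemma card_shared_edges s t :
  #|s| = 3 -> #|t| = 3 -> s != t -> #|E s :&: E t| <= 1.
Proof.
move=> s3 t3 st; rewrite leqNgt; apply: contra st => /card_gt1P[f [g [+ + fg]]].
rewrite !(in_setI _ (E s) (E t)) => /andP[fs ft] /andP[gs gt].
by rewrite -(setU_shared_edges s3 fs gs fg) -(setU_shared_edges t3 ft gt fg).
Qed.

(** Applied to two triangles that share an edge, the pair of vertices that
    together with them makes a complete graph on four vertices. *)
Definition crossbar s t : {set T} := (s :\: t) :|: (t :\: s).

Lemma shared_edge_tips s t :
  #|s| = 3 -> #|t| = 3 -> s != t -> ~~ [disjoint E s & E t] ->
  [/\ #|s :&: t| = 2, #|s :\: t| = 1 & #|t :\: s| = 1].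
Proof.
move=> s3 t3 st /pred0Pn[f /andP[/= fs ft]].
move: fs ft; rewrite !inE => /andP[fs /eqP f2] /andP[ft _].
have le2 : 2 <= #|s :&: t| by rewrite -f2 subset_leq_card // subsetI fs ft.
have lt3 : #|s :&: t| < 3.
  rewrite -s3 proper_card // properE subsetIl subsetI subxx /=.
  by apply: contra st => sub; rewrite eqEcard sub s3 t3.
have i2 : #|s :&: t| = 2 by lia.
have := cardsID t s; have := cardsID s t; rewrite (setIC t s) i2 s3 t3.
by split=> //; lia.
Qed.

Lemma card_crossbar s t :
  #|s| = 3 -> #|t| = 3 -> s != t -> ~~ [disjoint E s & E t] ->
  #|crossbar s t| = 2.
Proof.
move=> s3 t3 st sh; have [_ ds dt] := shared_edge_tips s3 t3 st sh.
rewrite /crossbar cardsU ds dt; suff -> : (s :\: t) :&: (t :\: s) = set0.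
  by rewrite cards0.
by apply/setP=> x; rewrite !inE; case: (x \in s); case: (x \in t).
Qed.

(** The triangle r takes one edge from each of s and t; the first contains the
    tip of s, the second the tip of t, and these two vertices are the ends of
    the crossbar. *)
Lemma crossbar_edge s t r :
  #|s| = 3 -> #|t| = 3 -> #|r| = 3 -> s != t -> ~~ [disjoint E s & E t] ->
  r != s -> r != t -> 1 < #|E r :&: (E s :|: E t)| -> crossbar s t \in E r.
Proof.
move=> s3 t3 r3 st sh rs rt /card_gt1P[f [g [+ + fg]]].
rewrite !(in_setI _ (E r)) !(in_setU _ (E s)).
move=> /andP[fr fst] /andP[gr gst].
have [_ /eqP/cards1P[v dv] /eqP/cards1P[x dx]] := shared_edge_tips s3 t3 st sh.
(* An edge of r in one of the two triangles only has the tip of it. *)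
have tip (p q : {set T}) w h : #|p| = 3 -> p :\: q = [set w] ->
    h \in E p -> h \notin E q -> w \in h.
  rewrite !inE => p3 dpq /andP[hp ->]; rewrite andbT => /subsetPn[y yh yq].
  have : y \in p :\: q by rewrite inE yq (subsetP hp).
  by rewrite dpq inE => /eqP <-.
have one (p h k : {set T}) : #|p| = 3 -> r != p ->
    h \in E r -> k \in E r -> h \in E p -> k \in E p -> h = k.
  move=> p3 rp hr kr hp kp; have /card_le1_eqP := card_shared_edges r3 p3 rp.
  by move=> /(_ h k); rewrite !(in_setI _ (E r)) hr kr hp kp => ->.
rewrite inE card_crossbar // eqxx andbT /crossbar dv dx subUset !sub1set.
have rr (h : {set T}) w : h \in E r -> w \in h -> w \in r.
  by rewrite inE => /andP[/subsetP hr _] /hr.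
have neq : f <> g by apply/eqP.
have [fs|fs] := boolP (f \in E s); have [gs|gs] := boolP (g \in E s).
- by case: neq; apply: (one s).
- have gt : g \in E t by move: gst; rewrite (negPf gs).
  have ft : f \notin E t by apply/negP=> ft; apply: neq; apply: (one t).
  by rewrite (rr f v fr (tip s t v f s3 dv fs ft))
    (rr g x gr (tip t s x g t3 dx gt gs)).
- have ft : f \in E t by move: fst; rewrite (negPf fs).
  have gt : g \notin E t by apply/negP=> gt; apply: neq; apply: (one t).
  by rewrite (rr g v gr (tip s t v g s3 dv gs gt))
    (rr f x fr (tip t s x f t3 dx ft fs)).
- move: fst gst; rewrite (negPf fs) (negPf gs) /= => ft gt.
  by case: neq; apply: (one t).
Qed.

Lemma crossbar_notin_third s t r f :
  #|s| = 3 -> #|t| = 3 -> #|r| = 3 -> s != t -> f \in E s -> f \in E t ->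
  f \in E r -> crossbar s t \notin E r.
Proof.
move=> s3 t3 r3 st fs ft fr; apply/negP=> cr.
have sh : ~~ [disjoint E s & E t] by apply/pred0Pn; exists f; rewrite /= fs ft.
have [i2 _ _] := shared_edge_tips s3 t3 st sh.
have dj : f :&: crossbar s t = set0.
  apply/setP=> x; rewrite !inE; apply/negP=> /andP[xf].
  move: fs ft; rewrite !inE => /andP[/subsetP/(_ _ xf)-> _].
  by move=> /andP[/subsetP/(_ _ xf)-> _].
move: fr cr; rewrite !inE => /andP[fr /eqP f2] /andP[cr /eqP c2].
have : #|f :|: crossbar s t| <= 3.
  by rewrite -r3 subset_leq_card // subUset fr cr.
by rewrite cardsU dj cards0 f2 c2.
Qed.

(** Colour the vertices with two colours.  Every triangle has a monochromatic
    edge, so the monochromatic edges of H meet all triangles inside H.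
    Recolouring one end of an edge toggles whether it is monochromatic, so
    every edge is so for half of the colourings, and some colouring makes at
    most half of H monochromatic. *)
Lemma half_cover (H : {set {set T}}) :
  (forall f, f \in H -> #|f| = 2) ->
  exists2 F : {set {set T}}, 2 * #|F| <= #|H| &
    forall t, #|t| = 3 -> E t \subset H -> ~~ [disjoint E t & F].
Proof.
move=> H2.
pose mono (f S : {set T}) := (f \subset S) || (f \subset ~: S).
have flip (f : {set T}) : f \in H -> 2 * #|[set S | mono f S]| = #|{set T}|.
  move=> /H2/eqP/cards2P[a [b [ab ->]]].
  (* Recolouring the vertex a exchanges the colourings for which the edge ab is
     monochromatic with the others. *)
  pose sw (S : {set T}) := if a \in S then S :\ a else a |: S.
  have swK : involutive sw.
    move=> S; rewrite /sw; have [aS|aS] := boolP (a \in S).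
      by rewrite !inE eqxx setD1K.
    by rewrite !inE eqxx setU1K.
  have mE S : mono [set a; b] S = ((a \in S) == (b \in S)).
    rewrite /mono !subUset !sub1set !inE.
    by case: (a \in S); case: (b \in S).
  rewrite mul2n -addnn -[RHS](cardsC [set S | mono [set a; b] S]).
  congr (_ + _).
  rewrite -(card_imset _ (inv_inj swK)); apply: eq_card => S.
  rewrite -[S in RHS]swK !inE mE.
  have -> : (S \in sw @: [set S0 | mono [set a; b] S0]) = mono [set a; b] (sw S).
    apply/imsetP/idP => [[S' + ->]|mS]; first by rewrite inE swK.
    by exists (sw S); rewrite ?inE ?swK.
  rewrite mE; move: (sw S) => S'; rewrite /sw.
  have [aS|aS] := boolP (a \in S'); rewrite !inE eqxx [b == a]eq_sym (negPf ab) /=.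
    by case: (b \in S').
  by case: (b \in S').
have [S hS] : exists S : {set T}, 2 * #|[set f in H | mono f S]| <= #|H|.
  apply/existsP; apply: contraT; rewrite negb_exists => /forallP hall.
  suff : \sum_(S : {set T}) (2 * #|[set f in H | mono f S]|) =
         \sum_(S : {set T}) #|H|.
    move=> eqs; have : \sum_(S : {set T}) #|H|.+1 <= \sum_(S : {set T}) #|H|.
      by rewrite -eqs; apply: leq_sum => S _; rewrite ltnNge hall.
    rewrite !sum_nat_const leq_pmul2l ?ltnn //.
    by apply/card_gt0P; exists set0.
  rewrite -big_distrr /=.
  under eq_bigr => S _ do rewrite -sum1dep_card.
  rewrite (exchange_big_dep (mem H)) /=; last by move=> S f _ /andP[].
  rewrite big_distrr /= sum_nat_const mulnC -sum_nat_const.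
  apply: eq_bigr => f fH; rewrite -[RHS](flip f fH) -sum1dep_card; congr (2 * _).
  by apply: eq_bigl => S; rewrite fH.
exists [set f in H | mono f S] => // t t3 tH.
(* X is a colour class with two vertices of t. *)
have [X [tX moX]] : exists X : {set T}, [/\ 1 < #|t :&: X| &
    forall f : {set T}, f \subset X -> mono f S].
  have := cardsID S t; rewrite t3 setDE => eq3.
  have [lt|le] := ltnP 1 #|t :&: S|.
    by exists S; split=> // f; rewrite /mono => ->.
  exists (~: S); split; last by move=> f; rewrite /mono orbC => ->.
  by lia.
have [a [b [+ + ab]]] := card_gt1P tX.
rewrite !inE => /andP[at_ aX] /andP[bt bX].
have ft : [set a; b] \in E t by rewrite inE cards2 ab subUset !sub1set at_ bt.
apply/pred0Pn; exists [set a; b]; rewrite /= ft /= inE (subsetP tH) //=.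
by apply: moX; rewrite subUset !sub1set aX bX.
Qed.

End Geometry.

(** * Families of triangles and diamonds *)

Section Families.

Variable T : finType.
Implicit Types (s t r f g x : {set T}) (A B : {set {set T}}).
Implicit Types (u v w : {set T} * {set T}) (U W : {set {set T} * {set T}}).
Local Notation E := triangle_edges.

(** A unit is a pair of triangles: two equal ones stand for a single triangle,
    two distinct ones that share an edge for a diamond. *)
Definition twin u := u.1 != u.2.
Definition unit_edges u := E u.1 :|: E u.2.
Definition spine u := if twin u then E u.1 :&: E u.2 else set0.
Definition covered U := \bigcup_(u in U) unit_edges u.

(** The first triangles of the units are those counted as packed; they are taken
    in A.  The second triangle of a diamond is taken in B, so that packing it
    instead of the first one never packs fewer triangles of B. *)
Definition packing_family A B U :=
  [forall u in U, (u.1 \in A) &&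
     (twin u ==> (u.2 \in B) && ~~ [disjoint E u.1 & E u.2])] &&
  [forall u in U, forall v in U,
     (u != v) ==> [disjoint unit_edges u & unit_edges v]].

(** An additional triangle is worth more than the three diamonds that it can
    destroy; the weight K puts the number of packed triangles in B in front. *)
Definition score K B U :=
  K * #|[set u in U | u.1 \in B]| + (4 * #|U| + #|[set u in U | twin u]|).

Definition optimal K A B U :=
  packing_family A B U /\
  forall W, packing_family A B W -> score K B W <= score K B U.

Lemma packing_familyP A B U :
  reflect [/\ forall u, u \in U -> u.1 \in A,
              forall u, u \in U -> twin u -> u.2 \in B,
              forall u, u \in U -> twin u -> ~~ [disjoint E u.1 & E u.2] &
              forall u v, u \in U -> v \in U -> u != v ->
                [disjoint unit_edges u & unit_edges v]]
          (packing_family A B U).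
Proof.
apply: (iffP andP) => [[/forall_inP ok /forall_inP dj]|[UA UB Us dj]]; split.
- by move=> u /ok/andP[].
- by move=> u /ok/andP[_ /implyP tw] /tw/andP[].
- by move=> u /ok/andP[_ /implyP tw] /tw/andP[].
- by move=> u v /dj/forall_inP dju /dju/implyP.
- apply/forall_inP=> u uU; rewrite UA //=; apply/implyP=> tw.
  by rewrite UB //= Us.
- by apply/forall_inP=> u uU; apply/forall_inP=> v vU; apply/implyP; apply: dj.
Qed.

Lemma exists_optimal K A B : exists U, optimal K A B U.
Proof.
have fam0 : packing_family A B set0.
  by apply/packing_familyP; split=> u; rewrite inE.
exists [arg max_(U > set0 | packing_family A B U) score K B U].
by case: arg_maxnP => // U fU maxU; split=> // W; apply: maxU.
Qed.

Lemma mem_covered U u f : u \in U -> f \in unit_edges u -> f \in covered U.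
Proof. by move=> uU fu; apply/bigcupP; exists u. Qed.

Lemma same_unit A B U u v f : packing_family A B U -> u \in U -> v \in U ->
  f \in unit_edges u -> f \in unit_edges v -> u = v.
Proof.
move=> /packing_familyP[_ _ _ dj] uU vU fu fv; apply/eqP/negPn/negP=> uv.
by move/(_ u v uU vU uv)/disjointFr/(_ fu): dj; rewrite fv.
Qed.

Lemma plain_edges t : unit_edges (t, t) = E t.
Proof. by rewrite /unit_edges setUid. Qed.

Section Improve.

Variables (K : nat) (A B : {set {set T}}) (U : {set {set T} * {set T}}).
Hypothesis A3 : forall t, t \in A -> #|t| = 3.
Hypothesis BA : B \subset A.
Hypothesis optU : optimal K A B U.

Let famU : packing_family A B U. Proof. by case: optU. Qed.
Let UA u : u \in U -> u.1 \in A.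
Proof. by case/packing_familyP: famU => h _ _ _; apply: h. Qed.
Let UB u : u \in U -> twin u -> u.2 \in B.
Proof. by case/packing_familyP: famU => _ h _ _; apply: h. Qed.
Let Us u : u \in U -> twin u -> ~~ [disjoint E u.1 & E u.2].
Proof. by case/packing_familyP: famU => _ _ h _; apply: h. Qed.
Let Udj u v : u \in U -> v \in U -> u != v ->
  [disjoint unit_edges u & unit_edges v].
Proof. by case/packing_familyP: famU => _ _ _ h; apply: h. Qed.
Let sameU u v f : u \in U -> v \in U ->
  f \in unit_edges u -> f \in unit_edges v -> u = v.
Proof. exact: same_unit famU. Qed.

Lemma unit_fst3 u : u \in U -> #|u.1| = 3.
Proof. by move=> uU; apply: A3; apply: UA. Qed.

Lemma unit_snd3 u : u \in U -> #|u.2| = 3.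
Proof.
move=> uU; have [tw|/negPn/eqP <-] := boolP (twin u); last exact: unit_fst3.
by apply: A3; apply: (subsetP BA); apply: UB.
Qed.

Lemma card_touched t : t \in A ->
  #|[set u in U | ~~ [disjoint E t & unit_edges u]]| <= 3.
Proof.
move=> tA; rewrite -(card_triangle_edges (A3 tA)).
pose g u := odflt set0 [pick f in E t :&: unit_edges u].
have gP u : ~~ [disjoint E t & unit_edges u] -> g u \in E t :&: unit_edges u.
  move=> /pred0Pn[f /= ftu]; rewrite /g; case: pickP => // /(_ f).
  by rewrite in_setI ftu.
rewrite -(@card_in_imset _ _ g).
  apply: subset_leq_card; apply/subsetP=> f /imsetP[u].
  by rewrite inE => /andP[_ /gP]; rewrite in_setI => /andP[gt _] ->.
move=> u v; rewrite !inE => /andP[uU /gP gu] /andP[vU /gP gv] eg.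
move: gu gv; rewrite !(in_setI _ (E t)) eg => /andP[_ gu] /andP[_ gv].
exact: sameU gu gv.
Qed.

(** Suppose that every unit u met by t can be replaced by a single triangle x
    off t.  Then adding t increases the score: the number of units grows by
    one, and at most three diamonds are lost.  The triangle x may lie outside u
    only if t has two edges in u, which happens for at most one unit; two
    replacements therefore never meet. *)
Lemma no_swap t : t \in A ->
  (forall u, u \in U -> ~~ [disjoint E t & unit_edges u] ->
     exists x, [/\ (x \in B) || (x == u.1), [disjoint E x & E t] &
       E x \subset unit_edges u \/
       1 < #|E t :&: unit_edges u| /\
         (forall v, v \in U -> v != u -> [disjoint E x & unit_edges v])]) ->
  False.
Proof.
move=> tA rep.
pose good u x := [&& (x \in B) || (x == u.1), [disjoint E x & E t] &
  (E x \subset unit_edges u) || (1 < #|E t :&: unit_edges u|) &&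
    [forall v in U, (v != u) ==> [disjoint E x & unit_edges v]]].
pose far u := [disjoint E t & unit_edges u].
(* The unit u is kept if far from t, and otherwise replaced by x_ u. *)
pose x_ u := odflt u.1 [pick x | good u x].
have x_P u : u \in U -> ~~ far u -> good u (x_ u).
  move=> uU /(rep u uU)[x [xB xt xu]]; rewrite /x_; case: pickP => // /(_ x).
  rewrite /good xB xt /=; case: xu => [-> //|[-> xv]]; rewrite orbC /=.
  by move=> /negP[]; apply/orP; left; apply/forall_inP=> v vU; apply/implyP; apply: xv.
pose phi u := if far u then u else (x_ u, x_ u).
have phi_far u : far u -> phi u = u by rewrite /phi => ->.
have phi_near u : ~~ far u -> phi u = (x_ u, x_ u).
  by rewrite /phi => /negPf ->.
have xA u : u \in U -> ~~ far u -> x_ u \in A.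
  move=> uU /(x_P u uU)/and3P[/orP[/(subsetP BA)//|/eqP ->] _ _]; exact: UA.
have phi_t u : u \in U -> [disjoint E t & unit_edges (phi u)].
  move=> uU; have [fu|fu] := boolP (far u); first by rewrite phi_far.
  rewrite phi_near // plain_edges disjoint_sym.
  by case/and3P: (x_P u uU fu).
have phi_sub u : u \in U -> unit_edges (phi u) \subset unit_edges u \/
    1 < #|E t :&: unit_edges u| /\
    (forall v, v \in U -> v != u ->
       [disjoint unit_edges (phi u) & unit_edges v]).
  move=> uU; have [fu|fu] := boolP (far u); first by left; rewrite phi_far.
  rewrite phi_near // plain_edges.
  case/and3P: (x_P u uU fu) => _ _ /orP[|/andP[? /forall_inP xv]]; first by left.
  by right; split=> // v vU; apply/implyP; apply: xv.
have phi_dj u v : u \in U -> v \in U -> u != v ->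
    [disjoint unit_edges (phi u) & unit_edges (phi v)].
  move=> uU vU uv.
  case: (phi_sub u uU) => [su|[gu du]]; case: (phi_sub v vU) => [sv|[gv dv]].
  - exact: disjointWl su (disjointWr sv (Udj uU vU uv)).
  - by rewrite disjoint_sym; apply: disjointWr su (dv u uU uv).
  - by apply: disjointWr sv (du v vU _); rewrite eq_sym.
  - have := card_triangle_edges (A3 tA).
    have : #|(E t :&: unit_edges u) :|: (E t :&: unit_edges v)| <= #|E t|.
      by rewrite subset_leq_card // subUset !subsetIl.
    rewrite cardsU; suff -> : (E t :&: unit_edges u) :&: (E t :&: unit_edges v)
        = set0 by rewrite cards0; lia.
    apply/setP=> f; rewrite in_setI !(in_setI _ (E t)) in_set0.
    apply/negP=> /andP[/andP[_ fu] /andP[_ fv]].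
    by case/eqP: uv; apply: sameU fu fv.
have phi_n0 u : u \in U -> unit_edges (phi u) != set0.
  move=> uU; rewrite -card_gt0 (leq_trans _ (subset_leq_card (subsetUl _ _))) //.
  rewrite card_triangle_edges //; have [fu|fu] := boolP (far u).
    by rewrite phi_far // unit_fst3.
  by rewrite phi_near //= A3 // xA.
have phi_inj : {in U &, injective phi}.
  move=> u v uU vU eqp; apply/eqP/negPn/negP=> uv.
  move: (phi_dj u v uU vU uv); rewrite eqp -setI_eq0 setIid.
  by apply/negP; apply: phi_n0.
pose W := (t, t) |: phi @: U.
have tW : (t, t) \notin phi @: U.
  apply/imsetP=> -[u uU et]; move: (phi_t u uU); rewrite -et plain_edges.
  by rewrite -setI_eq0 setIid -cards_eq0 card_triangle_edges ?A3.
have famW : packing_family A B W.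
  apply/packing_familyP; split.
  - move=> w /setU1P[-> //|/imsetP[u uU ->]].
    have [fu|fu] := boolP (far u); first by rewrite phi_far // UA.
    by rewrite phi_near //= xA.
  - move=> w /setU1P[->|/imsetP[u uU ->]]; first by rewrite /twin eqxx.
    have [fu|fu] := boolP (far u); first by rewrite phi_far // => /(UB uU).
    by rewrite phi_near // /twin eqxx.
  - move=> w /setU1P[->|/imsetP[u uU ->]]; first by rewrite /twin eqxx.
    have [fu|fu] := boolP (far u); first by rewrite phi_far // => /(Us uU).
    by rewrite phi_near // /twin eqxx.
  - move=> w1 w2 /setU1P[->|/imsetP[u uU ->]] /setU1P[->|/imsetP[v vU ->]].
    + by rewrite eqxx.
    + by move=> _; rewrite plain_edges phi_t.
    + by move=> _; rewrite plain_edges disjoint_sym phi_t.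
    + by move=> puv; apply: phi_dj => //; apply: contraNneq puv => ->.
have arith a b c d n : c <= d + 3 -> a <= b ->
    b + (4 * n.+1 + d) <= a + (4 * n + c) -> False by lia.
have cW : #|W| = #|U|.+1 by rewrite cardsU1 tW card_in_imset.
have leB : #|[set u in U | u.1 \in B]| <= #|[set w in W | w.1 \in B]|.
  rewrite -[leqLHS](@card_in_imset _ _ phi); last first.
    by move=> u v /setIdP[uU _] /setIdP[vU _]; apply: phi_inj.
  apply: subset_leq_card; apply/subsetP=> w /imsetP[u /setIdP[uU uB] ->].
  rewrite inE in_setU1 imset_f ?orbT //=.
  have [fu|fu] := boolP (far u); first by rewrite phi_far.
  rewrite phi_near //=.
  by case/and3P: (x_P u uU fu) => /orP[//|/eqP ->].
have leT : #|[set u in U | twin u]| <= #|[set w in W | twin w]| + 3.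
  apply: leq_trans (leq_add (leqnn _) (card_touched tA)).
  rewrite (leq_trans _ (leq_card_setU _ _)) // subset_leq_card //.
  apply/subsetP=> u /setIdP[uU tu].
  rewrite in_setU; have [fu|nfu] := boolP (far u); last first.
    by apply/orP; right; rewrite inE uU.
  apply/orP; left; apply/setIdP; split=> //.
  by rewrite -(phi_far u fu) setU1r ?imset_f.
have : K * #|[set u in U | u.1 \in B]| <= K * #|[set w in W | w.1 \in B]|.
  by rewrite leq_mul2l leB orbT.
by move=> leKB; have := optU.2 W famW; rewrite /score cW => /(arith _ _ _ _ _ leT leKB).
Qed.

Let U1 u : u \in U -> #|u.1| = 3. Proof. exact: unit_fst3. Qed.
Let U2 u : u \in U -> #|u.2| = 3. Proof. exact: unit_snd3. Qed.

Lemma card_spine u : u \in U -> twin u -> #|spine u| = 1.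
Proof.
move=> uU tw; apply/eqP; rewrite eqn_leq /spine tw.
rewrite card_shared_edges ?U1 ?U2 //= card_gt0.
by move: (Us uU tw); rewrite -setI_eq0.
Qed.

Lemma spine_sub1 u : spine u \subset E u.1.
Proof. by rewrite /spine; case: ifP => _; rewrite ?subsetIl ?sub0set. Qed.

Lemma spine_sub2 u : spine u \subset E u.2.
Proof. by rewrite /spine; case: ifP => _; rewrite ?subsetIr ?sub0set. Qed.

Lemma spine_sub u : spine u \subset unit_edges u.
Proof. exact: subset_trans (spine_sub1 u) (subsetUl _ _). Qed.

(** A single triangle could be made into a diamond. *)
Lemma no_page u t : u \in U -> ~~ twin u -> t \in B -> t != u.1 ->
  ~~ [disjoint E u.1 & E t] ->
  (forall v, v \in U -> v != u -> [disjoint E t & unit_edges v]) -> False.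
Proof.
move=> uU ntw tB tu sh dj; pose W := (u.1, t) |: U :\ u.
have uuE : unit_edges u = E u.1.
  by rewrite /unit_edges -(eqP (negPn ntw)) setUid.
have wU : (u.1, t) \notin U :\ u.
  rewrite in_setD1; apply/andP=> -[_ uU']; move: ntw => /negPn/eqP e.
  have [f fE] : exists f, f \in E u.1.
    by apply/card_gt0P; rewrite card_triangle_edges ?U1.
  have eu : u = (u.1, t).
    by apply: (@sameU _ _ f) => //; rewrite in_setU fE.
  by move: tu; rewrite [u.1]e eu eqxx.
have famW : packing_family A B W.
  have djt v : v \in U :\ u -> [disjoint unit_edges (u.1, t) & unit_edges v].
    rewrite in_setD1 => /andP[vu vU]; rewrite /unit_edges -setI_eq0 setIUl.
    rewrite setU_eq0 !setI_eq0 /= [X in _ && X]dj // andbT.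
    by rewrite -uuE; apply: Udj; rewrite 1?eq_sym.
  apply/packing_familyP; split.
  - by move=> w /setU1P[->|/setD1P[_ /UA]] //=; apply: UA.
  - by move=> w /setU1P[-> //|/setD1P[_ /UB]]; apply.
  - by move=> w /setU1P[-> //|/setD1P[_ /Us]]; apply.
  - move=> w1 w2 /setU1P[->|h1] /setU1P[->|h2]; first by rewrite eqxx.
    + by move=> _; apply: djt.
    + by move=> _; rewrite disjoint_sym; apply: djt.
    + by move: h1 h2 => /setD1P[_ h1] /setD1P[_ h2]; apply: Udj.
have := optU.2 W famW; rewrite /score !card_setId_sum -!sum1_card.
rewrite !(big_setU1 _ wU) !(big_setD1 u uU) /= (negPf ntw) {1}/twin /= eq_sym tu.
by rewrite !leq_add2l add0n add1n ltnn.
Qed.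

(** A triangle that shares at most one edge with an optimal family can be added
    to it, if it shares none; made into a new diamond, if the edge is in a
    single triangle; added after a diamond has retreated to its other triangle,
    if the edge is a leg.  Only a spine remains. *)
Lemma near_spine t : t \in A -> #|E t :&: covered U| <= 1 ->
  (t \in B) || [disjoint E t & covered U] ->
  exists2 u, u \in U & twin u && (E t :&: covered U == spine u).
Proof.
move=> tA le1 tB; have [dj|/pred0Pn[g /= /andP[gt gU]]] :=
  boolP [disjoint E t & covered U].
  exfalso; apply: (no_swap tA) => u uU /negP[].
  by apply: disjointWr dj; apply: bigcup_sup.
have {}tB : t \in B.
  by case/orP: tB => // /disjointFr/(_ gt); rewrite gU.
have onlyg f : f \in E t -> f \in covered U -> f = g.
  move=> ft fU; move/card_le1_eqP: le1 => /(_ f g).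
  by rewrite !(in_setI _ (E t)) ft gt fU gU => ->.
have /bigcupP[u uU gu] := gU.
have dj v : v \in U -> v != u -> [disjoint E t & unit_edges v].
  move=> vU vu; apply/pred0Pn=> -[f /= /andP[ft fv]].
  have fg := onlyg f ft (mem_covered vU fv); case/eqP: vu.
  by apply: sameU fv _ => //; rewrite fg.
have [tw|ntw] := boolP (twin u); last first.
  exfalso; apply: (@no_page u t) => //.
    apply: contraTneq le1 => tu; rewrite -ltnNge.
    have -> : E t :&: covered U = E t.
      apply/setIidPl; rewrite tu; apply: subset_trans (bigcup_sup _ uU).
      exact: subsetUl.
    by rewrite card_triangle_edges ?A3.
  apply/pred0Pn; exists g; rewrite /= gt andbT; move: gu.
  by rewrite in_setU -(eqP (negPn ntw)) orbb.
have [gs|gs] := boolP (g \in spine u).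
  exists u => //; rewrite tw /=; have /eqP/cards1P[h sh] := card_spine uU tw.
  apply/eqP/setP=> f; rewrite in_setI sh in_set1.
  move: gs; rewrite sh in_set1 => /eqP <-; apply/andP/eqP => [[]|->] //.
  exact: onlyg.
exfalso; apply: (no_swap tA) => v vU tv.
have -> : v = u by apply/eqP/negPn/negP=> /(dj v vU); apply/negP.
have [g1|g1] := boolP (g \in E u.1).
  exists u.2; rewrite UB //; split=> //; last by left; rewrite subsetUr.
  apply/pred0Pn=> -[f /= /andP[f2 ft]]; case/negP: gs.
  have fg : f = g.
    by apply: onlyg => //; apply: (mem_covered uU); rewrite in_setU f2 orbT.
  by rewrite /spine tw in_setI g1 -fg f2.
exists u.1; rewrite eqxx orbT; split=> //; last by left; rewrite subsetUl.
apply/pred0Pn=> -[f /= /andP[f1 ft]]; case/negP: g1.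
by rewrite -(onlyg f) //; apply: (mem_covered uU); rewrite in_setU f1.
Qed.

(** For a diamond u of the family: a third triangle of B contains its spine, and
    no other edge of the family. *)
Definition book u := [exists t in B, E t :&: covered U == spine u].

(** The edges of u that are needed to meet all triangles: two or even one, if u
    is a diamond. *)
Definition core u :=
  if twin u then
    spine u :|: (if book u then set0 else [set crossbar u.1 u.2])
  else E u.1.

Lemma card_core u : u \in U -> #|core u| + twin u + (twin u && book u) <= 3.
Proof.
move=> uU; rewrite /core; case: ifP => tw /=; last first.
  by rewrite card_triangle_edges ?U1.
rewrite -addnA -[3]/(1 + 1 + 1) -addnA.
apply: leq_trans (leq_add (leq_card_setU _ _) (leqnn _)) _.
by rewrite card_spine //; case: (book u); rewrite ?cards0 ?cards1.
Qed.

(** A triangle t that avoids all cores meets only diamonds, and no spine.  A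
    diamond met in one leg retreats to its triangle without that leg.  A diamond
    met in two legs has its crossbar in t, so the crossbar is not in its core;
    its spine then is in a third triangle, and the diamond retreats to that one,
    which t does not meet. *)
Lemma core_hits t : t \in A -> ~~ [disjoint E t & \bigcup_(u in U) core u].
Proof.
move=> tA; apply/negP=> dj; apply: (no_swap tA) => u uU tu.
have dju : [disjoint E t & core u] by apply: disjointWr dj; apply: bigcup_sup.
have [tw|ntw] := boolP (twin u); last first.
  case/negP: tu; move: dju; rewrite /core (negPf ntw) /unit_edges.
  by rewrite -(eqP (negPn ntw)) setUid.
have djs : [disjoint E t & spine u].
  by apply: disjointWr dju; rewrite /core tw subsetUl.
have [big|small] := ltnP 1 #|E t :&: unit_edges u|; last first.
  have /pred0Pn[g /= /andP[gt gu]] := tu.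
  have onlyg f : f \in E t -> f \in unit_edges u -> f = g.
    move=> ft fu; move/card_le1_eqP: small => /(_ f g).
    by rewrite !(in_setI _ (E t)) ft gt fu gu => ->.
  have [g1|g1] := boolP (g \in E u.1).
    exists u.2; rewrite UB //; split=> //; last by left; rewrite subsetUr.
    apply/pred0Pn=> -[f /= /andP[f2 ft]].
    have fg : f = g by apply: onlyg => //; rewrite in_setU f2 orbT.
    move/disjointFr/(_ ft): djs; rewrite /spine tw in_setI f2 fg g1; done.
  exists u.1; rewrite eqxx orbT; split=> //; last by left; rewrite subsetUl.
  apply/pred0Pn=> -[f /= /andP[f1 ft]]; case/negP: g1.
  by rewrite -(onlyg f) // in_setU f1.
have /eqP/cards1P[h sh] := card_spine uU tw.
have hs : h \in spine u by rewrite sh set11.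
have h1 := subsetP (spine_sub1 u) h hs.
have h2 := subsetP (spine_sub2 u) h hs.
have neq x : h \in E x -> t != x.
  by apply: contraTneq => <-; rewrite (disjointFl djs hs).
have ct : crossbar u.1 u.2 \in E t.
  by apply: crossbar_edge; rewrite ?U1 ?U2 ?A3 ?neq // Us.
have /exists_inP[r rB /eqP rs] : book u.
  apply: contraTT isT => nb; move/disjointFr/(_ ct): dju.
  by rewrite /core tw (negPf nb) in_setU set11 orbT.
have r3 : #|r| = 3 by apply: A3; apply: (subsetP BA).
have rcov f : f \in E r -> f \in covered U -> f \in spine u.
  by move=> fr fU; rewrite -rs in_setI fr fU.
have hr : h \in E r by move: hs; rewrite -rs => /setIP[].
exists r; rewrite rB; split=> //; last first.
  right; split=> // v vU; apply: contraNT => /pred0Pn[f /= /andP[fr fv]].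
  have fs := rcov f fr (mem_covered vU fv); apply/eqP.
  exact: sameU fv (subsetP (spine_sub u) f fs).
apply/pred0Pn=> -[f /= /andP[fr ft]].
have cnot (q : {set T}) : #|q| = 3 -> h \in E q -> crossbar u.1 u.2 \notin E q.
  by move=> q3; apply: crossbar_notin_third; rewrite ?U1 ?U2.
have fnot : f \notin unit_edges u.
  apply: contraFN (disjointFr djs ft) => fu.
  exact: rcov fr (mem_covered uU fu).
suff fc : f = crossbar u.1 u.2 by move: fr; rewrite fc (negPf (cnot r r3 hr)).
have : #|E t :\: unit_edges u| <= 1.
  rewrite -(leq_add2l #|E t :&: unit_edges u|) cardsID addn1.
  by rewrite card_triangle_edges ?A3.
move/card_le1_eqP/(_ f (crossbar u.1 u.2)); rewrite !in_setD.
by rewrite fnot ft ct in_setU negb_or !cnot ?U1 ?U2 // => ->.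
Qed.

End Improve.
End Families.

(** * Two nested optimal families *)

Section Main.

Variables (T : finType) (e : rel T).
Implicit Types (s t r f g x : {set T}) (A B : {set {set T}}).
Implicit Types (u v w : {set T} * {set T}) (U W : {set {set T} * {set T}}).
Local Notation E := triangle_edges.
Local Notation Tri := (triangles e).

Lemma triangle3 t : t \in Tri -> #|t| = 3.
Proof. by rewrite inE => /andP[/eqP]. Qed.

Lemma triangle_edges_sub t : t \in Tri -> E t \subset edges e.
Proof.
rewrite inE => /andP[_ te]; apply/subsetP=> f; rewrite inE => /andP[ft /cards2P].
move=> [x [y [xy def_f]]]; move: ft; rewrite {}def_f subUset !sub1set.
move=> /andP[xt yt]; apply/imsetP; exists (x, y) => //; rewrite inE /=.
by move/forall_inP: te => /(_ x xt)/forall_inP/(_ y yt)/implyP; apply.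
Qed.

Lemma tau_leq (C : {set {set T}}) :
  (forall t, t \in Tri -> ~~ [disjoint E t & C]) -> tau e <= #|C|.
Proof.
move=> hit; rewrite /tau; case: arg_minnP; first exact: edges_transversal.
move=> F _ minF; apply: leq_trans (minF (C :&: edges e) _) _; last first.
  by rewrite subset_leq_card ?subsetIl.
apply/andP; split; first exact: subsetIr.
apply/forall_inP=> t tT; have /pred0Pn[f /= /andP[ft fC]] := hit t tT.
apply/exists_inP; exists f => //.
by rewrite in_setI fC (subsetP (triangle_edges_sub tT)).
Qed.

Lemma packing_family_nu A B U : A \subset Tri -> packing_family A B U ->
  #|U| <= nu e.
Proof.
move=> AT fU; have /packing_familyP[UA _ _ Udj] := fU.
have E0 u : u \in U -> exists f, f \in E u.1.
  move=> uU; apply/card_gt0P.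
  by rewrite card_triangle_edges ?triangle3 ?(subsetP AT) ?UA.
have dj u v : u \in U -> v \in U -> u != v -> [disjoint E u.1 & E v.1].
  move=> uU vU uv; have := Udj u v uU vU uv.
  by move/(disjointWl (subsetUl _ _))/(disjointWr (subsetUl _ _)).
rewrite -(@card_in_imset _ _ fst); last first.
  move=> u v uU vU uv; apply/eqP/negPn/negP=> /(dj u v uU vU).
  have [f fu] := E0 u uU; move/disjointFr/(_ fu); by rewrite -uv fu.
rewrite /nu; apply: leq_bigmax_cond; apply/andP; split.
  by apply/subsetP=> t /imsetP[u uU ->]; apply: (subsetP AT); apply: UA.
apply/forall_inP=> s /imsetP[u uU ->]; apply/forall_inP=> t /imsetP[v vU ->].
by apply/implyP=> uv; apply: dj => //; apply: contraNneq uv => ->.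
Qed.

Definition spines U := \bigcup_(u in U) spine u.
Definition sides U := covered U :\: spines U.
Definition spine_free U := [set t in Tri | [disjoint E t & spines U]].
Definition two_sided U := [set t in spine_free U | #|E t :&: sides U| == 2].

Section Covers.

Variables (U U' : {set {set T} * {set T}}).
Hypothesis optU : optimal 0 Tri Tri U.

Let bases := spines U.
Let H := sides U.
Let A := spine_free U.
Let B := two_sided U.
Variable K : nat.
(* A family of k units has at most k diamonds, so the part of its score without
   K is at most 5k. *)
Hypothesis K_large : 5 * #|[set: {set T} * {set T}]| < K.
Hypothesis optU' : optimal K A B U'.

Let n := #|U|.
Let d := #|[set u in U | twin u]|.
Let n' := #|U'|.
Let m := #|[set u in U' | u.1 \in B]|.
Let p := #|[set u in U' | twin u]|.
Let y := #|[set u in U' | twin u && book B U' u]|.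

Let T3 := triangle3.
Let AT : A \subset Tri.
Proof. by apply/subsetP=> t /setIdP[]. Qed.
Let A3 t : t \in A -> #|t| = 3.
Proof. by move=> /(subsetP AT)/T3. Qed.
Let BA : B \subset A.
Proof. by apply/subsetP=> t /setIdP[]. Qed.
Let TT : Tri \subset Tri := subxx _.

Lemma tau_first_core : tau e + d <= 3 * n.
Proof.
have hit t : t \in Tri -> ~~ [disjoint E t & \bigcup_(u in U) core Tri U u].
  exact: core_hits T3 TT optU t.
have := leq_trans (tau_leq hit) (card_bigcup_leq _ _).
rewrite -(leq_add2r d) => /leq_trans; apply.
rewrite /d card_setId_sum -big_split /= mulnC -sum_nat_const.
apply: leq_sum => u uU; have := card_core T3 TT optU uU.
by apply: leq_trans; rewrite leq_addr.
Qed.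

Lemma card_bases : #|bases| <= d.
Proof.
apply: leq_trans (card_bigcup_leq _ _) _; rewrite /d card_setId_sum.
apply: leq_sum => u uU; have [tw|ntw] := boolP (twin u).
  by rewrite (card_spine T3 TT optU uU tw).
by rewrite /spine (negPf ntw) cards0.
Qed.

Lemma card_sides : #|H| <= 3 * n + d.
Proof.
have sub : H \subset \bigcup_(u in U) (unit_edges u :\: spine u).
  apply/subsetP=> f /setDP[/bigcupP[u uU fu] fb]; apply/bigcupP; exists u => //.
  by rewrite in_setD fu andbT; apply: contra fb => fs; apply/bigcupP; exists u.
apply: leq_trans (subset_leq_card sub) _.
apply: leq_trans (card_bigcup_leq _ _) _.
rewrite /d card_setId_sum mulnC /n -sum_nat_const -big_split /=.
apply: leq_sum => u uU.
have e1 := card_triangle_edges (unit_fst3 T3 optU uU).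
have e2 := card_triangle_edges (unit_snd3 T3 TT optU uU).
rewrite cardsD (setIidPr (spine_sub u)) /unit_edges cardsU e1 e2.
have [tw|ntw] := boolP (twin u).
  by have := card_spine T3 TT optU uU tw; rewrite {1}/spine tw => ->;
    rewrite (card_spine T3 TT optU uU tw).
by rewrite -(eqP (negPn ntw)) setIid e1 /spine (negPf ntw) cards0.
Qed.

(** By [near_spine], a triangle with at most one edge in U has a spine in U. *)
Lemma two_sides t : t \in A -> 1 < #|E t :&: H|.
Proof.
move=> tA; have /setIdP[tT djt] := tA.
have eH : E t :&: H = E t :&: covered U.
  apply/setP=> f; rewrite !in_setI in_setD; have [ft|//] := boolP (f \in E t).
  by rewrite (disjointFr djt ft).
rewrite ltnNge eH; apply/negP=> le1.
have [|u uU /andP[tw /eqP es]] := near_spine T3 TT optU tT le1.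
  by rewrite tT.
have /eqP/cards1P[f sf] := card_spine T3 TT optU uU tw.
have fs : f \in spine u by rewrite sf set11.
have ft : f \in E t by move: (fs); rewrite -es => /setIP[].
have : f \in bases by apply/bigcupP; exists u.
by rewrite (disjointFr djt ft).
Qed.

Let card_sides_of t : t \in A -> #|E t :&: H| = if t \in B then 2 else 3.
Proof.
move=> tA; rewrite inE tA /=; case: eqP => [//|/eqP ne2].
apply/eqP; rewrite eqn_leq ltn_neqAle eq_sym ne2 two_sides // andbT.
by rewrite -(card_triangle_edges (A3 tA)) subset_leq_card ?subsetIl.
Qed.

Lemma tau_second_core : tau e + p + y <= d + 3 * n'.
Proof.
pose C := bases :|: \bigcup_(u in U') core B U' u.
have hit t : t \in Tri -> ~~ [disjoint E t & C].
  move=> tT; have [tb|tb] := boolP [disjoint E t & bases].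
    have tA : t \in A by rewrite inE tT.
    apply: contra (core_hits A3 BA optU' tA).
    by apply: disjointWr; apply: subsetUr.
  by apply: contra tb; apply: disjointWr; apply: subsetUl.
rewrite -addnA; apply: leq_trans (leq_add (tau_leq hit) (leqnn _)) _.
apply: leq_trans (leq_add (leq_card_setU _ _) (leqnn _)) _.
rewrite -addnA; apply: leq_add card_bases _.
apply: leq_trans (leq_add (card_bigcup_leq _ _) (leqnn _)) _.
rewrite /p /y !card_setId_sum -!big_split /= mulnC -sum_nat_const.
by apply: leq_sum => u uU; rewrite addnA (card_core A3 BA optU').
Qed.

(** Let t avoid the spines of U, all sides in the packed triangles of U', and
    the legs of the second triangles of its diamonds.  As t has at most one edge
    that is not a side, it has at most one edge in U'; by [near_spine] this is
    the spine of a diamond of U', and t makes that diamond a book. *)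
Lemma tau_second_legs : tau e + m <= d + 3 * n' + 2 * p + y.
Proof.
pose L u := ((E u.1 :&: H) :|: (E u.2 :\: E u.1)) :|:
  (if twin u && book B U' u then spine u else set0).
pose C := bases :|: \bigcup_(u in U') L u.
have hit t : t \in Tri -> ~~ [disjoint E t & C].
  move=> tT; apply/negP=> djC.
  have tA : t \in A.
    by rewrite inE tT; apply: disjointWr djC; apply: subsetUl.
  have djL u : u \in U' -> [disjoint E t & L u].
    move=> uU; apply: disjointWr djC; apply: subset_trans (subsetUr _ _).
    exact: bigcup_sup.
  have sub : E t :&: covered U' \subset E t :\: H.
    apply/subsetP=> f /setIP[ft /bigcupP[u uU fu]]; rewrite in_setD ft andbT.
    apply/negP=> fH; move/disjointFr/(_ ft): (djL u uU); rewrite /L.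
    rewrite !in_setU in_setI in_setD fH andbT; move: fu; rewrite in_setU.
    by case: (f \in E u.1) => /= [|->].
  have := cardsID H (E t); rewrite (card_triangle_edges (A3 tA)).
  rewrite (card_sides_of tA) => cD.
  have le1 : #|E t :&: covered U'| <= 1.
    apply: leq_trans (subset_leq_card sub) _.
    by rewrite -(leq_add2l 2) -[2 + 1]/3 -[leqRHS]cD leq_add2r; case: ifP.
  have tB : (t \in B) || [disjoint E t & covered U'].
    move: cD; case: ifP => //= _ /eqP; rewrite -[X in _ == X]addn0 eqn_add2l.
    by rewrite cards_eq0 -setI_eq0 => /eqP e0; rewrite -subset0 -e0.
  have [u uU /andP[tw /eqP es]] := near_spine A3 BA optU' tA le1 tB.
  have /eqP/cards1P[f sf] := card_spine A3 BA optU' uU tw.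
  have fs : f \in spine u by rewrite sf set11.
  have /setIP[ft fc] : f \in E t :&: covered U' by rewrite es.
  have {}tB : t \in B.
    by case/orP: tB => // /disjointFr/(_ ft); rewrite fc.
  have bk : book B U' u by apply/exists_inP; exists t; rewrite ?es.
  move/disjointFr/(_ ft): (djL u uU); rewrite /L tw bk /= in_setU fs.
  by rewrite orbT.
apply: leq_trans (leq_add (tau_leq hit) (leqnn _)) _.
apply: leq_trans (leq_add (leq_card_setU _ _) (leqnn _)) _.
rewrite -addnA -!(addnA d); apply: leq_add card_bases _.
apply: leq_trans (leq_add (card_bigcup_leq _ _) (leqnn _)) _.
rewrite /m /p /y !card_setId_sum mulnC -sum_nat_const big_distrr -!big_split /=.
apply: leq_sum => u uU.
have /packing_familyP[UA _ Us _] := optU'.1.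
have c1 := card_sides_of (UA u uU).
have c2 : #|E u.2 :\: E u.1| <= 2 * twin u.
  have [tw|ntw] := boolP (twin u); last first.
    by rewrite -(eqP (negPn ntw)) setDv cards0.
  have := cardsID (E u.1) (E u.2).
  rewrite (card_triangle_edges (unit_snd3 A3 BA optU' uU)) setIC.
  by have := card_spine A3 BA optU' uU tw; rewrite /spine tw => ->; lia.
have c3 : #|if twin u && book B U' u then spine u else set0| <=
    twin u && book B U' u.
  case: andP => [[tw _]|_]; last by rewrite cards0.
  by rewrite (card_spine A3 BA optU' uU tw).
rewrite addnC; apply: leq_trans (leq_add (leqnn _) (leq_card_setU _ _)) _.
rewrite addnA; apply: leq_add c3.
apply: leq_trans (leq_add (leqnn _) (leq_card_setU _ _)) _.
rewrite addnA; apply: leq_add c2.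
by rewrite c1; case: (u.1 \in B).
Qed.

(* The weight K makes m the maximum size of a packing inside B. *)
Let card_two_sided_leq W : packing_family A B W ->
  #|[set u in W | u.1 \in B]| <= m.
Proof.
move=> fW; have := optU'.2 W fW; rewrite /score -/m -/n' -/p => le.
rewrite leqNgt; apply/negP=> lt.
have np : n' <= #|[set: {set T} * {set T}]| by rewrite subset_leq_card ?subsetT.
have pn : p <= n' by rewrite subset_leq_card //; apply/subsetP=> u /setIdP[].
have : K * m.+1 <= K * #|[set u in W | u.1 \in B]| by rewrite leq_mul2l lt orbT.
by rewrite mulnS; move: le np pn K_large; clear; lia.
Qed.

(** Let M be the set of edges of the m packed triangles in B.  A triangle t that
    avoids the spines of U and the sides in M has its sides outside M.  If it
    has three sides, they are all in H minus M.  If it has two, then its third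
    edge is in M, since otherwise t could be added to a packing inside B of
    maximum size.  So the edges of t are in the symmetric difference of H and M,
    of which half suffices. *)
Lemma tau_half : 2 * tau e <= 3 * n + 3 * d + 3 * m.
Proof.
pose M := \bigcup_(u in [set u in U' | u.1 \in B]) E u.1.
have /packing_familyP[UA _ _ Udj] := optU'.1.
have M2 u : u \in [set u in U' | u.1 \in B] ->
    #|E u.1 :&: H| = 2 /\ #|E u.1 :\: H| = 1.
  move=> /setIdP[uU uB]; have := card_sides_of (UA u uU).
  rewrite uB => c2; split=> //; have := cardsID H (E u.1).
  by rewrite c2 card_triangle_edges ?A3 ?UA // => /eqP; rewrite (eqn_add2l 2 _ 1) => /eqP.
have sM (D : {set {set T}}) k : (forall u, u \in [set u in U' | u.1 \in B] ->
    #|E u.1 :&: D| = k) -> #|M :&: D| <= m * k.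
  move=> hk; rewrite /M big_distrl /=; apply: leq_trans (card_bigcup_leq _ _) _.
  by rewrite /m -sum_nat_const; apply: leq_sum => u /hk ->.
have MH : #|M :&: H| <= m * 2 by apply: sM => u /M2[].
have MD : #|M :\: H| <= m.
  by rewrite setDE -[m]muln1; apply: sM => u /M2[]; rewrite setDE.
have edge2 f : f \in M :|: H -> #|f| = 2.
  have E2 t : f \in E t -> #|f| = 2 by rewrite inE => /andP[_ /eqP].
  case/setUP=> [/bigcupP[u _ /E2] //|/setDP[/bigcupP[u _]]].
  by case/setUP=> /E2.
have [|F F2 Fhit] := @half_cover _ ((H :\: M) :|: (M :\: H)).
  move=> f /setUP[/setDP[fH _]|/setDP[fM _]]; apply: edge2.
    by rewrite in_setU fH orbT.
  by rewrite in_setU fM.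
pose C := bases :|: ((M :&: H) :|: F).
have hit t : t \in Tri -> ~~ [disjoint E t & C].
  move=> tT; apply/negP=> djC.
  have tA : t \in A by rewrite inE tT; apply: disjointWr djC; apply: subsetUl.
  have djM : [disjoint E t & M :&: H].
    apply: disjointWr djC; apply: subset_trans (subsetUr _ _).
    exact: subsetUl.
  have /negP[] : ~~ [disjoint E t & F]; last first.
    apply: disjointWr djC; apply: subset_trans (subsetUr _ _).
    exact: subsetUr.
  apply: Fhit; first exact: A3.
  apply/subsetP=> f ft; apply/setUP; have [fH|fH] := boolP (f \in H).
    left; apply/setDP; split=> //; apply/negP=> fM.
    by have := disjointFr djM ft; rewrite in_setI fM fH.
  right; apply/setDP; split=> //; apply: contraT => fM.
  have tB : t \in B.
    have := card_sides_of tA; case: ifP => // _ c3.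
    have : E t :&: H == E t.
      by rewrite eqEcard subsetIl c3 card_triangle_edges ?A3.
    by move/eqP/setIidPl/subsetP/(_ f ft); rewrite (negPf fH).
  have djt : [disjoint E t & M].
    apply/pred0Pn=> -[g /= /andP[gt gM]].
    have gH : g \notin H.
      by apply/negP=> gH; have := disjointFr djM gt; rewrite in_setI gM gH.
    have le1 : #|E t :\: H| <= 1.
      have := cardsID H (E t); rewrite card_triangle_edges ?A3 //.
      by rewrite (card_sides_of tA) tB => /eqP; rewrite (eqn_add2l 2 _ 1) => /eqP ->.
    have fD : f \in E t :\: H by apply/setDP.
    have gD : g \in E t :\: H by apply/setDP.
    by move: fM; rewrite (card_le1_eqP le1 g f gD fD) gM.
  (* The packed triangles in B, as single triangles, together with t. *)
  pose plain u := (u.1, u.1).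
  pose S := [set u in U' | u.1 \in B].
  pose W := (t, t) |: plain @: S.
  have E3 u : u \in S -> #|E u.1| = 3.
    by move=> /setIdP[uU _]; rewrite card_triangle_edges ?A3 ?UA.
  have djS u v : u \in S -> v \in S -> u != v -> [disjoint E u.1 & E v.1].
    move=> /setIdP[uU _] /setIdP[vU _] /(Udj u v uU vU).
    by move/(disjointWl (subsetUl _ _))/(disjointWr (subsetUl _ _)).
  have djtS u : u \in S -> [disjoint E t & E u.1].
    by move=> uS; apply: disjointWr djt; apply: (bigcup_sup u).
  have tS : (t, t) \notin plain @: S.
    apply/imsetP=> -[u uS [tu _]]; have := djtS u uS; rewrite -tu.
    by rewrite -setI_eq0 setIid -cards_eq0 card_triangle_edges ?A3.
  have inj : {in S &, injective plain}.
    move=> u v uS vS [uv _]; apply/eqP/negPn/negP=> /(djS u v uS vS).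
    by rewrite -uv -setI_eq0 setIid -cards_eq0 E3.
  have famW : packing_family A B W.
    apply/packing_familyP; split.
    - move=> w /setU1P[->|/imsetP[u /setIdP[uU _] ->]]; first exact: tA.
      exact: (UA u uU).
    - by move=> w /setU1P[->|/imsetP[u _ ->]]; rewrite /twin eqxx.
    - by move=> w /setU1P[->|/imsetP[u _ ->]]; rewrite /twin eqxx.
    - move=> w1 w2 /setU1P[->|/imsetP[u uS ->]] /setU1P[->|/imsetP[v vS ->]];
        rewrite ?plain_edges.
      + by rewrite eqxx.
      + by move=> _; apply: djtS.
      + by move=> _; rewrite disjoint_sym; apply: djtS.
      + by move=> uv; apply: djS => //; apply: contraNneq uv => ->.
  have := card_two_sided_leq famW; rewrite leqNgt => /negP[].
  have -> : [set u in W | u.1 \in B] = W.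
    apply/setP=> w; rewrite inE andb_idr // => /setU1P[->|/imsetP[u uS ->]].
      exact: tB.
    by case/setIdP: uS.
  by rewrite cardsU1 tS card_in_imset.
have cF : #|(H :\: M) :|: (M :\: H)| + #|M :&: H| <= 3 * n + d + m.
  apply: leq_trans (leq_add (leq_card_setU _ _) (leqnn _)) _.
  rewrite addnAC; apply: leq_add MD.
  by rewrite addnC setIC cardsID card_sides.
have cC : #|C| <= d + (#|M :&: H| + #|F|).
  apply: leq_trans (leq_card_setU _ _) _; apply: leq_add card_bases _.
  exact: leq_card_setU.
have := tau_leq hit; move: cC cF F2 MH; clear.
move: #|C| #|M :&: H| #|_ :|: _| #|F| => c a b f; lia.
Qed.

Lemma score_compare : 4 * n' + p <= 4 * n + d.
Proof.
have /packing_familyP[UA UB Us Udj] := optU'.1.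
suff fU' : packing_family Tri Tri U'.
  by have := optU.2 U' fU'; rewrite /score !mul0n !add0n.
apply/packing_familyP; split.
- by move=> u uU; apply: (subsetP AT); apply: (UA u uU).
- by move=> u uU tw; apply: (subsetP AT); apply: (subsetP BA); apply: (UB u uU tw).
- exact: Us.
- exact: Udj.
Qed.

Lemma tau_nu_covers : 20 * tau e <= 57 * nu e.
Proof.
have := packing_family_nu AT optU'.1; have := packing_family_nu TT optU.1.
move: tau_first_core tau_half tau_second_legs tau_second_core score_compare.
rewrite -/n -/n'; clearbody n n' d m p y; clear; lia.
Qed.

End Covers.

Lemma tau_nu : 20 * tau e <= 57 * nu e.
Proof.
have [U optU] := exists_optimal 0 Tri Tri.
have [U' optU'] := exists_optimal (5 * #|[set: {set T} * {set T}]|).+1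
  (spine_free U) (two_sided U).
by apply: (tau_nu_covers optU _ optU').
Qed.

End Main.

Import Order.TTheory GRing.Theory Num.Theory.
Local Open Scope ring_scope.

Theorem mainTheorem3 (R : rcfType) (T : finType) (e : rel T)
    (e_sym : symmetric e) (e_irr : irreflexive e) :
  (tau e)%:R <= (162 + 4 * Num.sqrt 3) / 59 * (nu e)%:R :> R.
Proof.
have le : 20 * (tau e)%:R <= 57 * (nu e)%:R :> R.
  by rewrite -!natrM ler_nat tau_nu.
have nu0 : 0 <= (nu e)%:R :> R := ler0n _ _.
have s3 : 17 / 10 <= Num.sqrt 3 :> R.
  rewrite -[X in X <= _]ger0_norm; last by lra.
  by rewrite -sqrtr_sqr ler_wsqrtr //; lra.
nra.
Qed.
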